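(* Let $B$ be a self-adjoint operator in a separable complex Hilbert space $\mathfrak{H}$. Let $G:\mathbb{R}\to[0,\infty)$ be an even function that is nondecreasing on $[0,\infty)$. Then for every $x\in\mathcal{D}(G(B))$, every $k\in\mathbb{N}=\{1,2,\dots\}$ and every $r>0$ with $G(r)>0$, $$\mathcal{E}_{r}(x,B)\leq \frac{\sqrt{k+1}}{2^{k}G(r)}\,\omega_{k}\left(\frac{\pi}{r},G(B)x,B\right).$$
   Context: $B$ is a (possibly unbounded, densely defined) self-adjoint operator in $\mathfrak{H}$ with spectral measure $E(\cdot)$; $G(B)=\int_{-\infty}^{\infty}G(\lambda)\,dE(\lambda)$ with its natural domain $\mathcal{D}(G(B))$. Entire vectors of exponential type: $C^\infty(B)=\bigcap_{n\ge 0}\mathcal{D}(B^n)$; for $\alpha>0$, $\mathfrak{E}^{\alpha}(B)=\{x\in C^\infty(B):\exists c>0\ \forall k\in\{0,1,2,\dots\}\ \|B^kx\|\le c\alpha^k\}$; $\mathfrak{E}(B)=\bigcup_{\alpha>0}\mathfrak{E}^\alpha(B)$. The type of $x\in\mathfrak{E}(B)$ is $\sigma(x,B)=\inf\{\alpha>0: x\in\mathfrak{E}^\alpha(B)\}$. Best approximation: for $x\in\mathfrak{H}$ and $r>0$, $\mathcal{E}_r(x,B)=\inf\{\|x-y\|: y\in\mathfrak{E}(B),\ \sigma(y,B)\le r\}$ (equivalently $\|x-E([-r,r])x\|$). Modulus of continuity: with $U(h)=\exp(ihB)$ and $\Delta_h^k=(U(h)-\mathbb{I})^k$, $\omega_k(t,x,B)=\sup_{0<\tau\le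 t}\|\Delta_\tau^k x\|$ for $t>0$, $k\in\mathbb{N}$. *)

(* Defs.v *)
From HB Require Import structures.
From mathcomp Require Import all_boot all_order all_algebra.
From mathcomp Require Import all_classical all_reals all_analysis.
From mathcomp Require Import complex.

Set Implicit Arguments.
Unset Strict Implicit.
Unset Printing Implicit Defensive.

Import Order.TTheory GRing.Theory Num.Theory.
Import numFieldNormedType.Exports.

Local Open Scope classical_set_scope.
Local Open Scope ring_scope.
Local Open Scope complex_scope.

(* The inner product [hdot] is linear in its first argument and conjugate-linear
   in its second one. *)
HB.mixin Record CompleteNormedModule_isHilbert (R : realType) H
    of CompleteNormedModule R[i] H := {
  hdot : {dot H for @Num.conj R[i]} ;
  sqr_norm_hdot : forall x : H, `|x| ^+ 2 = hdot x x
}.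

#[short(type="hilbertType")]
HB.structure Definition Hilbert (R : realType) :=
  { H of CompleteNormedModule R[i] H & CompleteNormedModule_isHilbert R H }.

Definition separable (T : topologicalType) :=
  exists2 D : set T, countable D & dense D.

(* The norm of a normed module over R[i] takes its values in R[i]; [rnorm] is
   the same norm as an element of R. It is used on vectors and on scalars. *)
Definition rnorm (R : realType) (V : normedZmodType R[i]) (v : V) : R :=
  complex.Re `|v|.

Section Norm.
Context (R : realType).

Lemma rnormE (V : normedZmodType R[i]) (v : V) : (rnorm v)%:C = `|v|.
Proof. exact/RRe_real/ger0_real/normr_ge0. Qed.

Lemma rnorm_ge0 (V : normedZmodType R[i]) (v : V) : 0 <= rnorm v.
Proof. rewrite -lecR rnormE; exact: normr_ge0. Qed.

Lemma rnorm0 (V : normedZmodType R[i]) : rnorm (0 : V) = 0.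
Proof. by rewrite /rnorm normr0. Qed.

Lemma ler_dist_rnorm (V : normedZmodType R[i]) (v w : V) :
  `|rnorm v - rnorm w| <= rnorm (v - w).
Proof.
rewrite -lecR rnormE (le_trans _ (ler_dist_dist v w)) // -(rnormE v) -(rnormE w) -rmorphB /=.
by rewrite normc_def /= expr0n addr0 sqrtr_sqr.
Qed.

Lemma cvg_rnorm (V : normedModType R[i]) (u : V^nat) (l : V) :
  u @ \oo --> l -> rnorm (u n) @[n --> \oo] --> rnorm l.
Proof.
move=> ul; apply/cvgrPdist_lt => e e0.
have e0' : 0 < e%:C by rewrite ltcR.
have /cvgrPdist_lt /(_ _ e0') := ul.
apply: filterS => n; rewrite -rnormE ltcR.
exact/le_lt_trans/ler_dist_rnorm.
Qed.

Lemma sqr_rnorm_hdot (H : hilbertType R) (x : H) :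
  (rnorm x ^+ 2)%:C = hdot x x.
Proof. by rewrite rmorphXn /= rnormE sqr_norm_hdot. Qed.

End Norm.

(* A possibly unbounded operator; the values of [opfun] outside [opdom] are
   irrelevant. *)
Record operator (R : realType) (H : hilbertType R) := Operator {
  opdom : set H ;
  opfun :> H -> H
}.

Section Operators.
Context (R : realType) (H : hilbertType R).
Implicit Types (A B : operator H) (x y : H).

Definition op_eq A B :=
  opdom A = opdom B /\ forall x, opdom A x -> A x = B x.

Definition linear_op B :=
  opdom B 0 /\
  forall (a : R[i]) x y, opdom B x -> opdom B y ->
    opdom B (a *: x + y) /\ B (a *: x + y) = a *: B x + B y.

(* (x, y) is in the graph of the adjoint of B *)
Definition adjoint_graph B x y :=
  forall z, opdom B z -> hdot (B z) x = hdot z y.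

Definition self_adjoint B :=
  [/\ linear_op B, dense (opdom B) &
      forall x y, adjoint_graph B x y <-> (opdom B x /\ B x = y)].

Fixpoint pow_dom B (n : nat) : set H :=
  if n is m.+1 then [set x | pow_dom B m x /\ opdom B (iter m B x)]
  else setT.

Definition smooth B : set H := \bigcap_n pow_dom B n.

Definition exp_type_le (alpha : R) B : set H :=
  [set x | smooth B x /\
    exists2 c : R, 0 < c & forall k : nat, rnorm (iter k B x) <= c * alpha ^+ k].

Definition exp_type_vectors B : set H :=
  [set x | exists2 alpha, 0 < alpha & exp_type_le alpha B x].

Definition exp_type x B : R :=
  inf [set alpha | 0 < alpha /\ exp_type_le alpha B x].

Definition best_approx (r : R) x B : R :=
  inf [set rnorm (x - y) | y in [set y | exp_type_vectors B y /\ exp_type y B <= r]].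

End Operators.

(* Projection-valued measures on the Borel sets of R; [E A] is unconstrained
   when A is not a Borel set. *)
Record projection_measure (R : realType) (H : hilbertType R) := ProjectionMeasure {
  pm_fun :> set R -> {linear H -> H} ;
  pm_sym : forall A, measurable A ->
    forall x y, hdot (pm_fun A x) y = hdot x (pm_fun A y) ;
  pm_set0 : forall x, pm_fun set0 x = 0 ;
  pm_setT : forall x, pm_fun setT x = x ;
  pm_setI : forall A B, measurable A -> measurable B ->
    forall x, pm_fun (A `&` B) x = pm_fun A (pm_fun B x) ;
  pm_sigma_additive : forall F : (set R)^nat,
    (forall n, measurable (F n)) -> trivIset setT F ->
    forall x, \sum_(0 <= i < n) pm_fun (F i) x @[n --> \oo]
              --> pm_fun (\bigcup_n F n) x
}.

Section SpectralMeasure.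
Context (R : realType) (H : hilbertType R) (E : projection_measure H).

(* The scalar measure A |-> (E(A)x, x); since E(A) is an orthogonal projection,
   this is ||E(A)x||^2. *)
Definition scalar_measure (x : H) (A : set R) : \bar R :=
  (rnorm (E A x) ^+ 2)%:E.

Context (x : H).

Let scalar_measure0 : scalar_measure x set0 = 0%E.
Proof. by rewrite /scalar_measure pm_set0 rnorm0 expr0n. Qed.

Let scalar_measure_ge0 A : (0 <= scalar_measure x A)%E.
Proof. by rewrite lee_fin sqr_ge0. Qed.

Let scalar_measure_sigma_additive : semi_sigma_additive (scalar_measure x).
Proof.
move=> F mF tF mUF; rewrite /scalar_measure.
have sumE n : (\sum_(0 <= i < n) (rnorm (E (F i) x) ^+ 2)%:E)%E =
    (rnorm (\sum_(0 <= i < n) E (F i) x) ^+ 2)%:E.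
  rewrite sumEFin; congr EFin; apply: (@complexI R).
  rewrite sqr_rnorm_hdot rmorph_sum /= linear_sumlz /=.
  rewrite !big_mkord; apply: eq_bigr => i _.
  rewrite sqr_rnorm_hdot linear_sumr (bigD1 i) //= big1 ?addr0 // => j ji.
  rewrite pm_sym // -pm_setI //.
  have /trivIsetP /(_ i j I I) -> := tF; last by rewrite eq_sym.
  by rewrite pm_set0 linear0.
under eq_fun do rewrite sumE.
apply: cvg_EFin; first by near=> n.
rewrite /comp /=; under eq_fun do rewrite expr2.
rewrite expr2.
have c := cvg_rnorm (pm_sigma_additive (p := E) (x := x) mF tF).
exact: (cvgM c c).
Unshelve. all: by end_near.
Qed.

HB.instance Definition _ := isMeasure.Build _ R R (scalar_measure x)
  scalar_measure0 scalar_measure_ge0 scalar_measure_sigma_additive.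

End SpectralMeasure.

Section SpectralIntegral.
Context (R : realType) (H : hilbertType R) (E : projection_measure H).
Implicit Types (f : R -> R[i]) (x y : H) (s : seq (R[i] * set R)).

(* The list s encodes the simple function \sum_((c, A) <- s) c * 1_A. *)
Definition simple_fun s (l : R) : R[i] := \sum_(p <- s) p.1 * \1_(p.2) l.

Definition simple_int s x : H := \sum_(p <- s) p.1 *: E p.2 x.

(* y is the integral of f dE(.)x: the limit of the integrals of simple functions
   converging to f in L^2(scalar_measure E x). *)
Definition is_spectral_int f x y :=
  exists s : (seq (R[i] * set R))^nat,
    [/\ forall n p, p \in s n -> measurable p.2,
        (\int[scalar_measure E x]_l
          (rnorm (f l - simple_fun (s n) l) ^+ 2)%:E)%E @[n --> \oo] --> 0%E
      & simple_int (s n) x @[n --> \oo] --> y].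

(* The operator \int f dE with its natural domain. *)
Definition spectral_op f : operator H := {|
  opdom := [set x | (\int[scalar_measure E x]_l (rnorm (f l) ^+ 2)%:E < +oo)%E] ;
  opfun := fun x => xget 0 (is_spectral_int f x)
|}.

Definition real_spectral_op (g : R -> R) : operator H :=
  spectral_op (fun l => (g l)%:C).

(* B = \int l dE(l), domains included *)
Definition spectral_measure_of (B : operator H) :=
  op_eq B (real_spectral_op id).

(* U(h) = exp(ihB), where B = \int l dE(l) *)
Definition unitary_group (h : R) : H -> H :=
  spectral_op (fun l => cos (h * l) +i* sin (h * l)).

Definition difference (k : nat) (h : R) (x : H) : H :=
  iter k (fun y => unitary_group h y - y) x.

Definition modulus_of_continuity (k : nat) (t : R) (x : H) : R :=
  sup [set rnorm (difference k tau x) | tau in [set tau | 0 < tau <= t]].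

End SpectralIntegral.

(* Main.v *)
Require Import Defs.
From HB Require Import structures.
From mathcomp Require Import all_boot all_order all_algebra.
From mathcomp Require Import all_classical all_reals all_analysis.
From mathcomp Require Import measurable_realfun measurable_fun_approximation.
From mathcomp Require Import complex ring lra.

Set Implicit Arguments.
Unset Strict Implicit.
Unset Printing Implicit Defensive.

Import Order.TTheory GRing.Theory Num.Theory.
Import numFieldNormedType.Exports.

Local Open Scope classical_set_scope.
Local Open Scope ring_scope.
Local Open Scope complex_scope.

(** Write [mu_x A = |E A x|^2], [K = [-r, r]], [y = G(B) x] and
    [om = omega_k(pi / r, y)].

    The vector [E K x] is an entire vector of type at most [r], because on the
    range of [E K] the operator [B] is bounded by [r] and maps that range into
    itself; so the best approximation is at most [|x - E K x|], whose square is
    [mu_x (~` K)] ([best_approx_le]).  Off [K] the weight [G] is at least [G r]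
    and [mu_y] has density [G^2] with respect to [mu_x], so
    [G r ^ 2 * mu_x (~` K) <= mu_y (~` K)].  It remains to prove
    [mu_y (~` K) <= (k + 1) / 4 ^ k * om ^ 2] ([scalar_measure_tail_le]).

    The spectral calculus gives
    [|Delta_h^k y|^2 = \int (2 (1 - cos (h l)))^k d mu_y(l)]
    ([sqr_rnorm_difference]).  Put [h = t / r], average over [0 <= t <= pi]
    against the weight [sin t], of total mass 2, and exchange the integrals by
    Tonelli's theorem: the left side becomes at most [2 om ^ 2], and on the
    right a point [l] off [K] contributes [2 ^ k] times the moment
    [M_k(s) = \int_0^pi sin t (1 - cos (s t))^k dt] with [s = |l| / r > 1].
    The claim is thus reduced to [M_k(s) >= 2 ^ (k + 1) / (k + 1)] for [s > 1]
    ([sine_moment_ge]).  Integrating by parts twice gives the recurrence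
    [((k+1)^2 s^2 - 1) M_(k+1) = (k+1) (2k+1) s^2 M_k - (1 - cos (s pi))^(k+1)],
    and the bound follows by induction from [1 - cos (s pi) <= 2]; up to a
    positive factor, each step leaves the margin [k (s^2 - 1) >= 0].

    The spectral integral of [f] at [x] is handled through its defining
    approximations: simple integrals are isometric from [L^2(mu_x)]
    ([simple_int_isometry]), so the integral exists for every square-integrable
    [f] ([spectral_int_exists]) and keeps the norm ([sqint_spectral_int]).
    Since the projections commute with it, an integral [y] of [f] at [x] has
    the spectral measure [|f|^2 d mu_x] ([scalar_measure_spectral_int],
    [integral_spectral_int]).  This density rule is what is iterated to compute
    the norm of a [k]-th difference, without multiplicativity of the integral. *)

(** * Norms and spectral projections *)

Section RealNorm.
Context (R : realType).

Lemma ler_rnormD (V : normedZmodType R[i]) (v w : V) :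
  rnorm (v + w) <= rnorm v + rnorm w.
Proof. by rewrite -lecR rmorphD /= !rnormE ler_normD. Qed.

Lemma rnormM (a b : R[i]) : rnorm (a * b) = rnorm a * rnorm b.
Proof. by apply: (@complexI R); rewrite rmorphM /= !rnormE normrM. Qed.

Lemma rnormN (V : normedZmodType R[i]) (v : V) : rnorm (- v) = rnorm v.
Proof. by rewrite /rnorm normrN. Qed.

Lemma sqr_rnormC (z : R[i]) :
  rnorm z ^+ 2 = complex.Re z ^+ 2 + complex.Im z ^+ 2.
Proof.
apply: (@complexI R); rewrite rmorphXn /= rnormE -add_Re2_Im2.
by rewrite rmorphD !rmorphXn.
Qed.

Lemma cvg_of_rnorm (V : normedModType R[i]) (u : V^nat) (l : V) :
  rnorm (u n - l) @[n --> \oo] --> (0 : R) -> u @ \oo --> l.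
Proof.
move=> ul; apply/cvgrPdist_lt => e e0.
have eR : e = (complex.Re e)%:C by apply/esym/RRe_real/gtr0_real.
rewrite eR in e0 *; rewrite ltcR in e0.
move/cvgrPdist_lt : ul => /(_ _ e0); apply: filterS => n.
by rewrite sub0r normrN ger0_norm ?rnorm_ge0// distrC -rnormE ltcR.
Qed.
End RealNorm.

Section Projections.
Context (R : realType) (H : hilbertType R) (E : projection_measure H).
Implicit Types (x y : H) (A : set R).

Let scalar_measure_fin x : fin_num_fun (scalar_measure E x).
Proof. by move=> A mA; rewrite /scalar_measure. Qed.

HB.instance Definition _ x :=
  Measure_isFinite.Build _ _ R (scalar_measure E x) (@scalar_measure_fin x).

Lemma scalar_measureT x : scalar_measure E x setT = (rnorm x ^+ 2)%:E.
Proof. by rewrite /scalar_measure pm_setT. Qed.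

(** Monotonicity of the scalar measure of [x] between [A] and [setT]. *)
Lemma pm_contraction A x : measurable A -> rnorm (E A x) <= rnorm x.
Proof.
move=> mA; rewrite -(@ler_pXn2r _ 2)// ?nnegrE ?rnorm_ge0//.
rewrite -lee_fin -(scalar_measureT x) -/(scalar_measure E x A).
by apply: le_measure; rewrite ?inE.
Qed.

Lemma pm_idem A x : measurable A -> E A (E A x) = E A x.
Proof. by move=> mA; rewrite -pm_setI// setIid. Qed.

Lemma pmC A B x : measurable A -> measurable B -> E A (E B x) = E B (E A x).
Proof. by move=> mA mB; rewrite -!pm_setI// setIC. Qed.

(** The vector [E A x] carries the restriction to [A] of the spectral measure of
    [x]; this turns integrals over [A] into integrals at another vector. *)
Lemma scalar_measure_pm A C x : measurable A -> measurable C ->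
  scalar_measure E (E A x) C = scalar_measure E x (C `&` A).
Proof. by move=> mA mC; rewrite /scalar_measure pm_setI. Qed.

Lemma cvg_pm (u : H^nat) (l : H) A : measurable A ->
  u @ \oo --> l -> E A (u n) @[n --> \oo] --> E A l.
Proof.
move=> mA ul; apply: cvg_of_rnorm.
have d0 : rnorm (u n - l) @[n --> \oo] --> (0 : R).
  rewrite -(rnorm0 H); apply: cvg_rnorm.
  rewrite -(subrr l); exact: (cvgB ul (cvg_cst l)).
apply: (squeeze_cvgr _ (cvg_cst 0) d0).
by apply: nearW => n; rewrite rnorm_ge0/= -linearB pm_contraction.
Qed.

(** Countable additivity applied to the partition [A, ~` A, set0, set0, ...]:
    the axioms of a projection measure give finite additivity only this way. *)
Lemma pm_subr_setC A x : measurable A -> x - E A x = E (~` A) x.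
Proof.
move=> mA.
pose F n : set R := if n is 0 then A else if n is 1 then ~` A else set0.
have mF n : measurable (F n) by case: n => [|[|n]]//=; exact: measurableC.
have tF : trivIset setT F.
  apply/trivIsetP => -[|[|i]] [|[|j]] _ _ //= _;
    by rewrite ?setICr ?setICl ?set0I ?setI0.
have UF : \bigcup_n F n = setT.
  apply/seteqP; split=> // l _.
  by have [Al|Al] := pselect (A l); [exists 0%N|exists 1%N].
have := pm_sigma_additive (p := E) (x := x) mF tF; rewrite UF pm_setT => cF.
have : \sum_(0 <= i < n) E (F i) x @[n --> \oo] --> E A x + E (~` A) x.
  rewrite -(cvg_shiftn 2)/=; apply: cvg_near_cst; apply: nearW => n.
  rewrite addn2 !big_nat_recl// big1 ?addr0// => i _ /=.
  by rewrite pm_set0.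
move=> /(cvg_unique _ cF) => /(_ (@norm_hausdorff _ _)) {1}->.
by rewrite addrC addKr.
Qed.

End Projections.

(** * Integrals of simple functions *)

Section SimpleIntegrals.
Context (R : realType) (H : hilbertType R) (E : projection_measure H).
Implicit Types (x y : H) (A : set R) (f g : R -> R[i]) (s t : seq (R[i] * set R)).

Definition simple_measurable s := forall p, p \in s -> measurable p.2.

(** [R[i]] is treated as the product of two copies of [R]. *)
Definition complex_measurable f :=
  measurable_fun setT (fun l => complex.Re (f l)) /\
  measurable_fun setT (fun l => complex.Im (f l)).

Definition scale_simple (a : R[i]) s := [seq (a * p.1, p.2) | p <- s].

Lemma simple_fun_lin a s t l : simple_fun (scale_simple a s ++ t) l =
  a * simple_fun s l + simple_fun t l.
Proof.
rewrite /simple_fun big_cat big_map /= mulr_sumr; congr (_ + _).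
by apply: eq_bigr => p _; rewrite mulrA.
Qed.

Lemma simple_int_lin a s t x : simple_int E (scale_simple a s ++ t) x =
  a *: simple_int E s x + simple_int E t x.
Proof.
rewrite /simple_int big_cat big_map /= scaler_sumr; congr (_ + _).
by apply: eq_bigr => p _; rewrite scalerA.
Qed.

Lemma simple_measurable_lin a s t : simple_measurable s ->
  simple_measurable t -> simple_measurable (scale_simple a s ++ t).
Proof.
move=> ms mt p; rewrite mem_cat => /orP[/mapP[q qs ->]|/mt//].
exact: (ms q).
Qed.

Lemma pm_simple_int A s x : measurable A -> simple_measurable s ->
  E A (simple_int E s x) = simple_int E s (E A x).
Proof.
move=> mA ms; rewrite /simple_int linear_sum big_seq [RHS]big_seq.
by apply: eq_bigr => p /ms mp; rewrite linearZ/= pmC.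
Qed.

Lemma complex_measurable_lin a f g : complex_measurable f ->
  complex_measurable g -> complex_measurable (fun l => a * f l + g l).
Proof.
move=> [fr fi] [gr gi]; case: a => a b; split.
- rewrite (_ : (fun l => _) = fun l => (a * complex.Re (f l) -
      b * complex.Im (f l)) + complex.Re (g l)).
    apply: measurable_funD => //; apply: measurable_funB;
      exact: measurable_funM.
  by apply/funext => l; case: (f l) => ? ?; case: (g l).
- rewrite (_ : (fun l => _) = fun l => (a * complex.Im (f l) +
      b * complex.Re (f l)) + complex.Im (g l)).
    apply: measurable_funD => //; apply: measurable_funD;
      exact: measurable_funM.
  by apply/funext => l; case: (f l) => ? ?; case: (g l).
Qed.

Lemma complex_measurable_indic A : measurable A ->
  complex_measurable (fun l => \1_A l).
Proof.
move=> mA; split.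
- rewrite (_ : (fun l => _) = \1_A); first exact: measurable_indic.
  by apply/funext => l; rewrite !indicE; case: (l \in A).
- rewrite (_ : (fun l => _) = cst 0); first exact: measurable_cst.
  by apply/funext => l; rewrite !indicE; case: (l \in A).
Qed.

Lemma complex_measurable_simple s : simple_measurable s ->
  complex_measurable (simple_fun s).
Proof.
elim: s => [|p s ih] ms.
  rewrite (_ : simple_fun _ = fun=> 0); first by split; exact: measurable_cst.
  by apply/funext => l; rewrite /simple_fun big_nil.
rewrite (_ : simple_fun _ = fun l => p.1 * \1_(p.2) l + simple_fun s l).
  apply: complex_measurable_lin.
    by apply: complex_measurable_indic; apply: ms; rewrite mem_head.
  by apply: ih => q qs; apply: ms; rewrite inE qs orbT.
by apply/funext => l; rewrite /simple_fun big_cons.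
Qed.

Lemma measurable_sqr_rnorm f : complex_measurable f ->
  measurable_fun setT (fun l => rnorm (f l) ^+ 2).
Proof.
move=> [fr fi]; under eq_fun do rewrite sqr_rnormC.
by apply: measurable_funD; exact: measurable_funX.
Qed.

Lemma sqr_rnormM_conj (z : R[i]) : rnorm z ^+ 2 = complex.Re (z * z^*).
Proof. by rewrite -normCK -rnormE -rmorphXn. Qed.

(** Both sides are the same hermitian sum of [c_i c_j^* |E (A_i & A_j) x|^2]:
    on the right because [(E A_i x, E A_j x) = |E (A_i & A_j) x|^2], on the left
    by integrating [1_(A_i) 1_(A_j) = 1_(A_i & A_j)].  The sets of the list may
    overlap, which is why the sum is kept double. *)
Lemma simple_int_isometry s x : simple_measurable s ->
  (\int[scalar_measure E x]_l (rnorm (simple_fun s l) ^+ 2)%:E =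
  (rnorm (simple_int E s x) ^+ 2)%:E)%E.
Proof.
move=> ms; pose n := size s.
pose c (i : 'I_n) := (tnth (in_tuple s) i).1.
pose A (i : 'I_n) := (tnth (in_tuple s) i).2.
have mA i : measurable (A i) by apply: ms; exact: mem_tnth.
(* the real parts suffice, since both sides are real *)
pose w (ij : 'I_n * 'I_n) := complex.Re (c ij.1 * (c ij.2)^*).
have funE l : rnorm (simple_fun s l) ^+ 2 =
    \sum_(ij : 'I_n * 'I_n) w ij * \1_(A ij.1 `&` A ij.2) l.
  rewrite sqr_rnormM_conj /simple_fun big_tnth rmorph_sum /= mulr_suml raddf_sum.
  rewrite -(pair_bigA _ (fun i j => w (i, j) * \1_(A i `&` A j) l))/=.
  apply: eq_bigr => i _; rewrite mulr_sumr raddf_sum; apply: eq_bigr => j _.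
  rewrite rmorphM /= /w /= -/(c i) -/(c j) -/(A i) -/(A j) mulrACA !indicE in_setI.
  by case: (l \in A i); case: (l \in A j);
    rewrite /= ?conjC1 ?conjC0 ?mulr1 ?mulr0.
have intE : rnorm (simple_int E s x) ^+ 2 =
    \sum_(ij : 'I_n * 'I_n) w ij * rnorm (E (A ij.1 `&` A ij.2) x) ^+ 2.
  have -> (v : H) : rnorm v ^+ 2 = complex.Re (hdot v v).
    by rewrite -sqr_rnorm_hdot.
  rewrite /simple_int big_tnth linear_sumlz raddf_sum.
  rewrite -(pair_bigA _ (fun i j => w (i, j) * rnorm (E (A i `&` A j) x) ^+ 2))/=.
  apply: eq_bigr => i _; rewrite linear_sumr raddf_sum; apply: eq_bigr => j _.
  rewrite linearZl_LR linearZr_LR /= -/(c i) -/(c j) -/(A i) -/(A j).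
  have -> : hdot (E (A i) x) (E (A j) x) =
      (rnorm (E (A i `&` A j) x) ^+ 2)%:C.
    rewrite sqr_rnorm_hdot !pm_sym//; last exact: measurableI.
    by rewrite pm_idem ?pm_setI//; exact: measurableI.
  by rewrite mulrA /w /=; case: (c i * _) => ? ? /=; rewrite mulr0 subr0.
under eq_integral do rewrite funE -sumEFin.
rewrite intE -sumEFin integral_sum//; last first.
  move=> ij; under eq_fun do rewrite EFinM; apply: integrableZl => //.
  apply: integrable_indic => //.
  exact: measurableI.
apply: eq_bigr => ij _; under eq_integral do rewrite EFinM.
rewrite integralZl//; last first.
  by apply: integrable_indic => //; exact: measurableI.
by rewrite integral_indic// ?setIT//; exact: measurableI.
Qed.
End SimpleIntegrals.

(** * Square integrals and the norm of a spectral integral *)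

Section SpectralIntegrals.
Context (R : realType) (H : hilbertType R) (E : projection_measure H).
Implicit Types (x y z : H) (A : set R) (f g : R -> R[i]).

(** The squared norm of [f] in [L^2(mu_x)]. *)
Definition sqint x f : \bar R :=
  (\int[scalar_measure E x]_l (rnorm (f l) ^+ 2)%:E)%E.

Lemma sqint_ge0 x f : (0 <= sqint x f)%E.
Proof. by apply: integral_ge0 => l _; rewrite lee_fin sqr_ge0. Qed.

Lemma le_sqint x f g : complex_measurable f -> complex_measurable g ->
  (forall l, rnorm (f l) <= rnorm (g l)) -> (sqint x f <= sqint x g)%E.
Proof.
move=> mf mg fg; apply: ge0_le_integral => //.
- by move=> l _; rewrite lee_fin sqr_ge0.
- by apply/measurable_EFinP; exact: measurable_sqr_rnorm.
- by apply/measurable_EFinP; exact: measurable_sqr_rnorm.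
- by move=> l _; rewrite lee_fin ler_pXn2r ?nnegrE ?rnorm_ge0.
Qed.

Lemma sqintZ x (a : R[i]) f : complex_measurable f ->
  sqint x (fun l => a * f l) = ((rnorm a ^+ 2)%:E * sqint x f)%E.
Proof.
move=> mf; rewrite /sqint; under eq_integral do rewrite rnormM exprMn EFinM.
rewrite ge0_integralZl_EFin ?sqr_ge0//.
- by move=> l _; rewrite lee_fin sqr_ge0.
- by apply/measurable_EFinP; exact: measurable_sqr_rnorm.
Qed.

Lemma complex_measurableD f g : complex_measurable f -> complex_measurable g ->
  complex_measurable (fun l => f l + g l).
Proof.
move=> mf mg; have := complex_measurable_lin 1 mf mg.
by congr complex_measurable; apply/funext => l; rewrite mul1r.
Qed.

Lemma complex_measurableB f g : complex_measurable f -> complex_measurable g ->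
  complex_measurable (fun l => f l - g l).
Proof.
move=> mf mg; have := complex_measurable_lin (-1) mg mf.
by congr complex_measurable; apply/funext => l; rewrite mulN1r addrC.
Qed.

(** The parametrised form of the triangle inequality: as [e] tends to [0] it
    loses nothing on [u], which replaces Minkowski in the passage to the limit. *)
Lemma sqr_rnormD_le (e : R) (u v : R[i]) : 0 < e ->
  rnorm (u + v) ^+ 2 <= (1 + e) * rnorm u ^+ 2 + (1 + e^-1) * rnorm v ^+ 2.
Proof.
move=> e0; apply: (@le_trans _ _ ((rnorm u + rnorm v) ^+ 2)).
  rewrite ler_pXn2r ?nnegrE ?addr_ge0 ?rnorm_ge0//; exact: ler_rnormD.
rewrite -subr_ge0.
rewrite (_ : _ - _ = e^-1 * (e * rnorm u - rnorm v) ^+ 2).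
  by rewrite mulr_ge0 ?sqr_ge0 ?invr_ge0 ?ltW.
by field; rewrite gt_eqF.
Qed.

Lemma sqintD_le (e : R) x f g : 0 < e ->
  complex_measurable f -> complex_measurable g ->
  (sqint x (fun l => f l + g l)%R <=
    (1 + e)%:E * sqint x f + (1 + e^-1)%:E * sqint x g)%E.
Proof.
move=> e0 mf mg.
have e1 : 0 <= 1 + e by rewrite addr_ge0// ltW.
have e2 : 0 <= 1 + e^-1 by rewrite addr_ge0// invr_ge0 ltW.
have mf2 := measurable_sqr_rnorm mf; have mg2 := measurable_sqr_rnorm mg.
have p0 (h : R -> R[i]) l : setT l -> (0 <= (rnorm (h l) ^+ 2)%:E)%E.
  by rewrite lee_fin sqr_ge0.
have Z (c : R) (h : R -> R[i]) : 0 <= c -> complex_measurable h ->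
    (c%:E * sqint x h =
     \int[scalar_measure E x]_l (c%:E * (rnorm (h l) ^+ 2)%:E))%E.
  move=> c0 mh; rewrite ge0_integralZl_EFin//; first exact: p0.
  by apply/measurable_EFinP; exact: measurable_sqr_rnorm.
rewrite !Z//.
rewrite -ge0_integralD//; last 4 first.
- by move=> l _; rewrite -EFinM lee_fin mulr_ge0 ?sqr_ge0.
- by apply/measurable_EFinP; exact: measurable_funM.
- by move=> l _; rewrite -EFinM lee_fin mulr_ge0 ?sqr_ge0.
- by apply/measurable_EFinP; exact: measurable_funM.
apply: ge0_le_integral => //; first exact: p0.
- apply/measurable_EFinP; apply: measurable_sqr_rnorm.
  exact: complex_measurableD.
- apply/measurable_EFinP; apply: measurable_funD; exact: measurable_funM.
- by move=> l _; rewrite -!EFinM -EFinD lee_fin sqr_rnormD_le.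
Qed.

Lemma cvge_lin2 (a b : R) (l : \bar R) (v w : (\bar R)^nat) :
  v @ \oo --> l -> w @ \oo --> 0%E ->
  (a%:E * v n + b%:E * w n)%E @[n --> \oo] --> (a%:E * l)%E.
Proof.
move=> vl w0; rewrite -[X in _ --> X]adde0 -[X in (_ + X)%E](mule0 b%:E).
apply: cvgeD; [|exact: cvgeZl..].
by rewrite mule0 fin_num_adde_defl.
Qed.

Lemma cvge0_le2 (a b : R) (u v w : (\bar R)^nat) :
  (forall n, 0 <= u n)%E -> (forall n, u n <= a%:E * v n + b%:E * w n)%E ->
  v @ \oo --> 0%E -> w @ \oo --> 0%E -> u @ \oo --> 0%E.
Proof.
move=> u0 uvw v0 w0.
have := @cvge_lin2 a b _ _ _ v0 w0; rewrite mule0 => h.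
apply: (squeeze_cvge _ (cvg_cst 0%E) h).
by apply: nearW => n; rewrite u0 uvw.
Qed.

(** Concatenating the approximating lists approximates the linear combination. *)
Lemma is_spectral_int_lin (a : R[i]) f g x y z :
  complex_measurable f -> complex_measurable g ->
  is_spectral_int E f x y -> is_spectral_int E g x z ->
  is_spectral_int E (fun l => a * f l + g l) x (a *: y + z).
Proof.
move=> mf mg [s [ms cs sy]] [t [mt ct tz]].
exists (fun n => scale_simple a (s n) ++ t n); split.
- by move=> n; exact: (simple_measurable_lin (ms n) (mt n)).
- apply: (cvge0_le2 (a := (1 + 1) * rnorm a ^+ 2) (b := 1 + 1^-1) _ _ cs ct).
    by move=> n; exact: sqint_ge0.
  move=> n; rewrite EFinM -muleA -sqintZ; last first.
    exact: complex_measurableB mf (complex_measurable_simple (ms n)).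
  apply: le_trans (sqintD_le _ ltr01 _ _).
  + rewrite le_eqVlt; apply/orP; left; apply/eqP; apply: eq_integral => l _.
    by rewrite simple_fun_lin; congr ((rnorm _ ^+ 2)%:E); ring.
  + have mfs := complex_measurableB mf (complex_measurable_simple (ms n)).
    rewrite (_ : (fun l => _) = fun l => a * (f l - simple_fun (s n) l) + cst 0 l).
      apply: complex_measurable_lin => //; split; exact: measurable_cst.
    by apply/funext => l; rewrite addr0.
  + exact: complex_measurableB mg (complex_measurable_simple (mt n)).
- under eq_fun do rewrite simple_int_lin.
  by apply: (@cvgD _ H) tz; apply: (@cvgZl_tmp _ H).
Qed.

Lemma ler_mul1D_gt0 (a b : R) : 0 <= b ->
  (forall e, 0 < e -> a <= (1 + e) * b) -> a <= b.
Proof.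
move=> b0 ab; apply/ler_addgt0Pr => d d0.
have b1 : 0 < b + 1 by rewrite ltr_wpDl.
apply: (le_trans (ab (d / (b + 1)) _)); first by rewrite divr_gt0.
rewrite mulrDl mul1r lerD2l mulrAC ler_pdivrMr// ler_wpM2l ?ltW//.
by rewrite ltrDl.
Qed.

(** A spectral integral has the norm of its integrand.  Both inequalities come
    from [sqintD_le] applied to [f = s_n + (f - s_n)] and to
    [s_n = f + (s_n - f)], letting first [n] tend to infinity and then [e]
    tend to [0]. *)
Lemma sqint_spectral_int f x y : complex_measurable f ->
  is_spectral_int E f x y -> sqint x f = (rnorm y ^+ 2)%:E.
Proof.
move=> mf [s [ms cs sy]].
have mS n := complex_measurable_simple (ms n).
have mfS n := complex_measurableB mf (mS n).
have cn : sqint x (simple_fun (s n)) @[n --> \oo] --> (rnorm y ^+ 2)%:E.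
  rewrite /sqint; under eq_fun do rewrite (simple_int_isometry _ _ (ms _)).
  apply: cvg_EFin; first by near=> n.
  rewrite /comp /= expr2; under eq_fun do rewrite expr2.
  exact: cvgM (cvg_rnorm sy) (cvg_rnorm sy).
(* also gives the finiteness of [sqint x f] *)
have up e : 0 < e -> (sqint x f <= (1 + e)%:E * (rnorm y ^+ 2)%:E)%E.
  move=> e0.
  have := @cvge_lin2 (1 + e) (1 + e^-1) _ _ _ cn cs; apply: cvge_ge; apply: nearW => n.
  apply: le_trans (sqintD_le x e0 (mS n) (mfS n)).
  by rewrite le_eqVlt; apply/orP; left; apply/eqP; apply: eq_integral => l _;
    rewrite subrKC.
have ffin : sqint x f \is a fin_num.
  rewrite ge0_fin_numE ?sqint_ge0//.
  by apply: le_lt_trans (up _ ltr01) _; rewrite -EFinM ltry.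
have lo e : 0 < e -> ((rnorm y ^+ 2)%:E <= (1 + e)%:E * sqint x f)%E.
  move=> e0.
  have h := @cvge_lin2 (1 + e) (1 + e^-1) _ _ _ (cvg_cst (sqint x f)) cs.
  apply: (lee_cvg_to cn (h _)); apply: nearW => n.
  have mSf := complex_measurableB (mS n) mf.
  rewrite -/(sqint x (fun l => f l - simple_fun (s n) l)).
  have -> : sqint x (fun l => f l - simple_fun (s n) l) =
      sqint x (fun l => simple_fun (s n) l - f l).
    by apply: eq_integral => l _; rewrite -opprB rnormN.
  apply: le_trans (sqintD_le x e0 mf mSf).
  by rewrite le_eqVlt; apply/orP; left; apply/eqP; apply: eq_integral => l _;
    rewrite subrKC.
rewrite -(fineK ffin) in up lo *; congr EFin; apply/eqP; rewrite eq_le.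
apply/andP; split; apply: ler_mul1D_gt0.
- exact: sqr_ge0.
- exact: up.
- by rewrite fine_ge0 ?sqint_ge0.
- exact: lo.
Unshelve. all: by end_near.
Qed.

End SpectralIntegrals.

(** * Simple approximation in mean square *)

Section Existence.
Context (R : realType) (H : hilbertType R) (E : projection_measure H).
Implicit Types (x y z : H) (A : set R) (f g : R -> R[i]).

Import HBNNSimple.

(** The level-set decomposition of a simple function. *)
Definition nnsfun_list (h : {nnsfun R >-> R}) : seq (R[i] * set R) :=
  [seq (v%:C, h @^-1` [set v]) | v <- finmap.enum_fset (fset_set (range h))].

Lemma simple_fun_nnsfun h l : simple_fun (nnsfun_list h) l = (h l)%:C.
Proof.
rewrite [in RHS]fimfunE fsbig_finite//= rmorph_sum /simple_fun big_map.
by apply: eq_bigr => v _; rewrite rmorphM /= !indicE rmorph_nat.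
Qed.

Lemma nnsfun_list_measurable h : simple_measurable (nnsfun_list h).
Proof. by move=> p /mapP[v _ ->] /=; exact: measurable_funPTI. Qed.

Lemma complex_measurable_real (g : R -> R) : measurable_fun setT g ->
  complex_measurable (fun l => (g l)%:C).
Proof. by move=> mg; split=> //=; exact: measurable_cst. Qed.

Lemma rnorm_real (a : R) : rnorm a%:C = `|a|.
Proof. by rewrite /rnorm normc_def /= expr0n addr0 sqrtr_sqr. Qed.

(** The increasing simple approximations of [g] converge in mean square by
    dominated convergence, as [(g - h_n)^2 <= g^2]. *)
Lemma simple_approx (g : R -> R) x : measurable_fun setT g ->
  (forall l, 0 <= g l) -> (sqint E x (fun l => (g l)%:C) < +oo)%E ->
  exists s : (seq (R[i] * set R))^nat, (forall n, simple_measurable (s n)) /\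
    sqint E x (fun l => (g l)%:C - simple_fun (s n) l) @[n --> \oo] --> 0%E.
Proof.
move=> mg g0 gfin.
have mEg : measurable_fun setT (EFin \o g) by exact/measurable_EFinP.
pose h := nnsfun_approx measurableT mEg.
exists (fun n => nnsfun_list (h n)); split.
  by move=> n; exact: nnsfun_list_measurable.
have hg l : h n l @[n --> \oo] --> g l.
  have Eg0 t : setT t -> (0 <= (EFin \o g) t)%E by rewrite lee_fin.
  by have /fine_cvgP[_] := cvg_nnsfun_approx measurableT mEg Eg0 (I : setT l).
have hle n l : h n l <= g l.
  rewrite -(cvg_lim _ (hg l))//; apply: (nondecreasing_cvgn_le (u_ := h^~ l)).
    by move=> i j ij; exact/lefP/nd_nnsfun_approx.
  by apply: cvgP (hg l).
have sqE n l : rnorm ((g l)%:C - simple_fun (nnsfun_list (h n)) l) ^+ 2 =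
    (g l - h n l) ^+ 2.
  by rewrite simple_fun_nnsfun -rmorphB/= rnorm_real real_normK ?num_real.
rewrite /sqint; under eq_fun do under eq_integral do rewrite sqE.
have mgh n : measurable_fun setT (fun l => (g l - h n l) ^+ 2).
  by apply/measurable_funX/measurable_funB => //.
have ig : (scalar_measure E x).-integrable setT (fun l => (g l ^+ 2)%:E).
  apply/integrableP; split; first by apply/measurable_EFinP; exact: measurable_funX.
  move: gfin; rewrite /sqint; congr (_ < _)%E; apply: eq_integral => l _.
  by rewrite rnorm_real real_normK ?num_real// gee0_abs// lee_fin sqr_ge0.
suff : (\int[scalar_measure E x]_l ((g l - h n l) ^+ 2)%:E)%E @[n --> \oo] -->
    (\int[scalar_measure E x]_l (cst 0%E l))%E by rewrite integral0.
have [|||||_ _] := @dominated_convergence _ _ _ (scalar_measure E x) setT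
  measurableT (fun n l => ((g l - h n l) ^+ 2)%:E) (cst 0%E)
  (fun l => (g l ^+ 2)%:E) => //.
- by move=> n; apply/measurable_EFinP.
- apply: aeW => l _ /=; apply: cvg_EFin; first by near=> n.
  have h0' : (g l - h n l) @[n --> \oo] --> (0 : R).
    by rewrite -(subrr (g l)); apply: cvgB => //; exact: cvg_cst.
  rewrite /comp /= -(mulr0 0); under eq_fun do rewrite expr2.
  exact: (cvgM h0' h0').
- apply: aeW => l n _ /=.
  by rewrite lee_fin ger0_norm ?sqr_ge0// ler_pXn2r ?nnegrE ?subr_ge0// lerBlDr lerDl.
Unshelve. all: by end_near.
Qed.

End Existence.

(** * Measures with a density *)

Section Density.
Context d (T : measurableType d) (R : realType).
Local Open Scope ereal_scope.

Import HBNNSimple.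

(** The case of an indicator function is the hypothesis; simple functions follow
    by additivity and the general case by monotone convergence. *)
Lemma integral_density (mu nu : {measure set T -> \bar R}) (w : T -> R)
    (h : T -> \bar R) :
  (forall t, 0 <= w t)%R -> measurable_fun setT w ->
  (forall A, measurable A -> nu A = \int[mu]_(t in A) (w t)%:E) ->
  (forall t, 0 <= h t) -> measurable_fun setT h ->
  \int[nu]_t h t = \int[mu]_t (h t * (w t)%:E).
Proof.
move=> w0 mw nuE h0 mh; pose u := nnsfun_approx measurableT mh.
have uh t : (u n t)%:E @[n --> \oo] --> h t.
  have h0' t' : setT t' -> 0 <= h t' by [].
  exact: (cvg_nnsfun_approx measurableT mh h0' (I : setT t)).
have und t m n : (m <= n)%N -> (u m t <= u n t)%R.
  by move=> mn; exact/lefP/nd_nnsfun_approx.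
have simple n : \int[nu]_t (u n t)%:E = \int[mu]_t ((u n t)%:E * (w t)%:E).
  have mF v : measurable_fun setT (fun t => (v * \1_(u n @^-1` [set v]) t)%:E).
    by apply/measurable_EFinP; apply: measurable_funM => //.
  have F0 v t : 0 <= (v * \1_(u n @^-1` [set v]) t)%:E.
    exact: nnfun_muleindic_ge0.
  have uE t : (u n t)%:E =
      \sum_(v \in range (u n)) (v * \1_(u n @^-1` [set v]) t)%:E.
    by rewrite fsumEFin// -fimfunE.
  have uwE t : (u n t)%:E * (w t)%:E =
      \sum_(v \in range (u n)) ((v * \1_(u n @^-1` [set v]) t)%:E * (w t)%:E).
    by rewrite -ge0_mule_fsuml// -uE.
  under eq_integral do rewrite uE.
  under [RHS]eq_integral do rewrite uwE.
  rewrite !ge0_integral_fsum//; first last.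
  - by move=> v t _; apply: mule_ge0 => //; rewrite lee_fin.
  - by move=> v; apply: emeasurable_funM => //; exact/measurable_EFinP.
  apply: eq_fsbigr => v /set_mem[t0 _ v0].
  have vge0 : (0 <= v)%R by rewrite -v0.
  have mv : measurable (u n @^-1` [set v]) by exact: measurable_funPTI.
  under eq_integral do rewrite EFinM.
  rewrite ge0_integralZl_EFin//; last first.
    by apply/measurable_EFinP; exact: measurable_indic.
  rewrite integral_indic// setIT nuE//.
  under [RHS]eq_integral do rewrite EFinM -muleA.
  rewrite ge0_integralZl_EFin//; last 2 first.
  - by move=> t _; rewrite -EFinM lee_fin mulr_ge0.
  - by apply/measurable_EFinP; apply: measurable_funM.
  rewrite [in LHS]integral_mkcond; congr (_ * _); apply: eq_integral => t _.
  rewrite /patch indicE; case: ifP => _; first by rewrite mul1e.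
  by rewrite mul0e.
transitivity (limn (fun n => \int[nu]_t (u n t)%:E)).
  rewrite -monotone_convergence//.
  - by apply: eq_integral => t _; apply/esym/cvg_lim.
  - by move=> n; exact/measurable_EFinP.
  - by move=> n t _; rewrite lee_fin.
  - by move=> t _ m n mn; rewrite lee_fin und.
under eq_fun do rewrite simple.
rewrite -monotone_convergence//.
- apply: eq_integral => t _; apply/cvg_lim => //.
  by apply: cvgeZr.
- by move=> n; apply: emeasurable_funM; exact/measurable_EFinP.
- by move=> n t _; rewrite -EFinM lee_fin mulr_ge0.
- by move=> t _ m n mn; rewrite -!EFinM lee_fin ler_wpM2r ?und.
Qed.
End Density.

(** * Existence of spectral integrals and their spectral measures *)

Section SpectralCalculus.
Context (R : realType) (H : hilbertType R) (E : projection_measure H).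
Implicit Types (x y z : H) (A : set R) (f g : R -> R[i]).

(** The integrals of an approximating sequence are Cauchy by the isometry, and
    the space is complete. *)
Lemma spectral_int_exists_ge0 (g : R -> R) x : measurable_fun setT g ->
  (forall l, 0 <= g l) -> (sqint E x (fun l => (g l)%:C) < +oo)%E ->
  exists y, is_spectral_int E (fun l => (g l)%:C) x y.
Proof.
move=> mg g0 gfin; have [s [ms cs]] := simple_approx mg g0 gfin.
have mgs n := complex_measurableB (complex_measurable_real mg)
  (complex_measurable_simple (ms n)).
pose dist n := sqint E x (fun l => (g l)%:C - simple_fun (s n) l).
have dE m n : ((rnorm (simple_int E (s m) x - simple_int E (s n) x) ^+ 2)%:E <=
    2%:E * dist m + 2%:E * dist n)%E.
  rewrite addrC -scaleN1r -simple_int_lin -simple_int_isometry; last first.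
    exact: (simple_measurable_lin (ms n) (ms m)).
  have -> : dist m = sqint E x (fun l => simple_fun (s m) l - (g l)%:C).
    by apply: eq_integral => l _; rewrite -opprB rnormN.
  have msg := complex_measurableB (complex_measurable_simple (ms m))
    (complex_measurable_real mg).
  have := sqintD_le E x ltr01 msg (mgs n); rewrite invr1 => /(le_trans _); apply.
  rewrite le_eqVlt; apply/orP; left; apply/eqP; apply: eq_integral => l _.
  by rewrite simple_fun_lin; congr ((rnorm _ ^+ 2)%:E); ring.
suff /cvg_ex[y sy] : cvg (simple_int E (s n) x @[n --> \oo]).
  by exists y, s.
apply: cauchy_cvg; apply: cauchy_exP => e e0.
have eR : e = (complex.Re e)%:C by apply/esym/RRe_real/gtr0_real.
rewrite eR in e0 *; rewrite ltcR in e0.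
have [fd /cvgrPdist_lt cd] := (fine_cvgP _ _).1 cs.
have e4 : 0 < complex.Re e ^+ 2 / 4 by rewrite divr_gt0 ?exprn_gt0.
have [N _ hN] : \forall n \near \oo, (dist n < (complex.Re e ^+ 2 / 4)%:E)%E.
  near=> n; have dn : dist n \is a fin_num by near: n.
  rewrite -(fineK dn) lte_fin.
  have : `|0 - fine (dist n)| < complex.Re e ^+ 2 / 4.
    by near: n; exact: (cd _ e4).
  by rewrite sub0r normrN ger0_norm// fine_ge0 ?sqint_ge0.
exists (simple_int E (s N) x), N => // n /= Nn.
rewrite -ball_normE /= -rnormE ltcR -(@ltr_pXn2r _ 2) ?nnegrE ?rnorm_ge0// ?ltW//.
rewrite -lte_fin; apply: le_lt_trans (dE _ _) _.
have hd k : (N <= k)%N -> (2%:E * dist k < (complex.Re e ^+ 2 / 2)%:E)%E.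
  move=> /hN h; have -> : complex.Re e ^+ 2 / 2 = 2 * (complex.Re e ^+ 2 / 4).
    by field.
  by rewrite EFinM lte_pmul2l.
by have := lteD (hd N (leqnn N)) (hd n Nn); rewrite -EFinD -splitr.
Unshelve. all: by end_near.
Qed.

(** The positive and negative parts of the real and imaginary parts are
    dominated by [|f|], so each of them has a spectral integral. *)
Lemma spectral_int_exists f x : complex_measurable f ->
  (sqint E x f < +oo)%E -> exists y, is_spectral_int E f x y.
Proof.
move=> mf ffin.
have part (g : R -> R) : measurable_fun setT g -> (forall l, 0 <= g l) ->
    (forall l, g l <= rnorm (f l)) ->
    complex_measurable (fun l => (g l)%:C) /\
    exists y, is_spectral_int E (fun l => (g l)%:C) x y.
  move=> mg g0 gf; have mgC := complex_measurable_real mg; split=> //.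
  apply: spectral_int_exists_ge0 => //; apply: le_lt_trans ffin.
  by apply: le_sqint => // l; rewrite rnorm_real ger0_norm.
have Re_le (c : R[i]) : `|complex.Re c| <= rnorm c.
  rewrite -(@ler_pXn2r _ 2) ?nnegrE ?rnorm_ge0// sqr_rnormC real_normK ?num_real//.
  by rewrite lerDl sqr_ge0.
have Im_le (c : R[i]) : `|complex.Im c| <= rnorm c.
  rewrite -(@ler_pXn2r _ 2) ?nnegrE ?rnorm_ge0// sqr_rnormC real_normK ?num_real//.
  by rewrite lerDr sqr_ge0.
pose u l := complex.Re (f l); pose v l := complex.Im (f l).
have [mu mv] : measurable_fun setT u /\ measurable_fun setT v := mf.
have posle (w : R -> R) l : w^\+ l <= `|w l| by rewrite /funrpos ge_max ler_norm normr_ge0.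
have negle (w : R -> R) l : w^\- l <= `|w l|.
  by rewrite /funrneg ge_max -normrN ler_norm normr_ge0.
have [mup [y1 i1]] := part _ (measurable_funrpos mu) (funrpos_ge0 u)
  (fun l => le_trans (posle u l) (Re_le _)).
have [mun [y2 i2]] := part _ (measurable_funrneg mu) (funrneg_ge0 u)
  (fun l => le_trans (negle u l) (Re_le _)).
have [mvp [y3 i3]] := part _ (measurable_funrpos mv) (funrpos_ge0 v)
  (fun l => le_trans (posle v l) (Im_le _)).
have [mvn [y4 i4]] := part _ (measurable_funrneg mv) (funrneg_ge0 v)
  (fun l => le_trans (negle v l) (Im_le _)).
have m14 := complex_measurable_lin (-1) mun mup.
have i14 := is_spectral_int_lin (-1) mun mup i2 i1.
have m143 := complex_measurable_lin (0 +i* 1) mvp m14.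
have i143 := is_spectral_int_lin (0 +i* 1) mvp m14 i3 i14.
have i1432 := is_spectral_int_lin (0 -i* 1) mvn m143 i4 i143.
rewrite (_ : f = fun l => (0 -i* 1) * (v^\- l)%:C + ((0 +i* 1) * (v^\+ l)%:C +
    (-1 * (u^\- l)%:C + (u^\+ l)%:C))); first by eexists; exact: i1432.
apply/funext => l.
have uE : u l = u^\+ l - u^\- l by rewrite -[in LHS](funrposBneg u).
have vE : v l = v^\+ l - v^\- l by rewrite -[in LHS](funrposBneg v).
have -> : f l = u l +i* v l by rewrite /u /v; case: (f l).
by rewrite uE vE; simpc; congr (_ +i* _); ring.
Qed.

Lemma spectral_opP f x : complex_measurable f -> (sqint E x f < +oo)%E ->
  is_spectral_int E f x (spectral_op E f x).
Proof. by move=> mf /(spectral_int_exists mf) yP; apply: (xgetPex 0 yP). Qed.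

Lemma integral_scalar_measure_pm A x (h : R -> \bar R) : measurable A ->
  (forall l, 0 <= h l)%E -> measurable_fun setT h ->
  (\int[scalar_measure E (E A x)]_l h l =
   \int[scalar_measure E x]_(l in A) h l)%E.
Proof.
move=> mA h0 mh.
rewrite (integral_density (mu := scalar_measure E x) (w := \1_A))//.
- rewrite [RHS]integral_mkcond; apply: eq_integral => l _.
  rewrite /patch indicE; case: ifP => _; first by rewrite mule1.
  by rewrite mule0.
- move=> C mC; rewrite integral_indic// setIC; exact: scalar_measure_pm.
Qed.

Lemma is_spectral_int_pm A f x y : measurable A -> complex_measurable f ->
  is_spectral_int E f x y -> is_spectral_int E f (E A x) (E A y).
Proof.
move=> mA mf [s [ms cs sy]]; exists s; split => //.
- apply: (squeeze_cvge _ (cvg_cst 0%E) cs); apply: nearW => n.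
  have mfs := measurable_sqr_rnorm (complex_measurableB mf
    (complex_measurable_simple (ms n))).
  rewrite integral_ge0/=; last by move=> l _; rewrite lee_fin sqr_ge0.
  rewrite integral_scalar_measure_pm//.
  + apply: ge0_subset_integral => //; first exact/measurable_EFinP.
    by move=> l _; rewrite lee_fin sqr_ge0.
  + by move=> l; rewrite lee_fin sqr_ge0.
  + exact/measurable_EFinP.
- under eq_fun => n do rewrite -(pm_simple_int _ _ mA (ms n)).
  exact: cvg_pm.
Qed.

(** Apply the norm identity to [E A y], which is the integral of [f] at [E A x]. *)
Lemma scalar_measure_spectral_int f x y A : measurable A ->
  complex_measurable f -> is_spectral_int E f x y ->
  (scalar_measure E y A =
   \int[scalar_measure E x]_(l in A) (rnorm (f l) ^+ 2)%:E)%E.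
Proof.
move=> mA mf fy; rewrite -integral_scalar_measure_pm//.
- exact: (esym (sqint_spectral_int mf (is_spectral_int_pm mA mf fy))).
- by move=> l; rewrite lee_fin sqr_ge0.
- by apply/measurable_EFinP; exact: measurable_sqr_rnorm.
Qed.

Lemma integral_spectral_int f x y (h : R -> \bar R) :
  complex_measurable f -> is_spectral_int E f x y ->
  (forall l, 0 <= h l)%E -> measurable_fun setT h ->
  (\int[scalar_measure E y]_l h l =
   \int[scalar_measure E x]_l (h l * (rnorm (f l) ^+ 2)%:E))%E.
Proof.
move=> mf fy h0 mh; apply: integral_density => //.
- by move=> l; exact: sqr_ge0.
- exact: measurable_sqr_rnorm.
- by move=> A mA; exact: scalar_measure_spectral_int.
Qed.

End SpectralCalculus.

(** * Differences of the unitary group *)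

Section Differences.
Context (R : realType) (H : hilbertType R) (E : projection_measure H).
Implicit Types (x y : H) (h l : R) (k : nat).

(** The one-term list [[:: (1, setT)]] is exact. *)
Lemma is_spectral_int1 x : is_spectral_int E (fun=> 1) x x.
Proof.
have f1 l : simple_fun [:: (1, setT)] l = 1 :> R[i].
  by rewrite /simple_fun big_seq1 /= indicT mulr1.
exists (fun=> [:: (1, setT)]); split.
- by move=> _ p; rewrite inE => /eqP ->; exact: measurableT.
- rewrite (_ : (fun _ => _) = cst 0%E); first exact: cvg_cst.
  apply/funext => n; apply: integral0_eq => l _.
  by rewrite f1 subrr rnorm0 expr0n.
- rewrite (_ : (fun _ => _) = cst x); first exact: cvg_cst.
  by apply/funext => n; rewrite /simple_int big_seq1 /= pm_setT scale1r.
Qed.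

Lemma measurable_cosZ h : measurable_fun setT (fun l => cos (h * l)).
Proof.
apply: measurableT_comp; first exact: (continuous_measurable_fun (@continuous_cos R)).
by apply: measurable_funM.
Qed.

Lemma measurable_sinZ h : measurable_fun setT (fun l => sin (h * l)).
Proof.
apply: measurableT_comp; first exact: (continuous_measurable_fun (@continuous_sin R)).
by apply: measurable_funM.
Qed.

Let phase h l : R[i] := cos (h * l) +i* sin (h * l).

Let measurable_phase h : complex_measurable (phase h).
Proof. by split; [exact: measurable_cosZ|exact: measurable_sinZ]. Qed.

Lemma is_spectral_int_unitary h x :
  is_spectral_int E (phase h) x (unitary_group E h x).
Proof.
apply: spectral_opP => //.
have -> : sqint E x (phase h) = scalar_measure E x setT.
  rewrite -[RHS]mul1e -[RHS]integral_cst//; apply: eq_integral => l _.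
  by rewrite sqr_rnormC /= cos2Dsin2.
by rewrite scalar_measureT ltry.
Qed.

Lemma difference1_spectral h x :
  complex_measurable (fun l => -1 * 1 + phase h l) /\
  is_spectral_int E (fun l => -1 * 1 + phase h l) x (unitary_group E h x - x).
Proof.
have m1 : complex_measurable (fun _ : R => 1 : R[i]).
  by split; exact: measurable_cst.
split; first exact: complex_measurable_lin.
rewrite addrC -(scaleN1r x).
exact: (is_spectral_int_lin (-1) m1 (measurable_phase h)
  (is_spectral_int1 x) (is_spectral_int_unitary h x)).
Qed.

(** One difference step replaces [x] by a vector whose spectral measure is
    [|e^(i h l) - 1|^2 d mu_x = 2 (1 - cos (h l)) d mu_x]; iterate. *)
Lemma sqr_rnorm_difference k h x :
  (rnorm (difference E k h x) ^+ 2)%:E =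
  (\int[scalar_measure E x]_l ((2 * (1 - cos (h * l))) ^+ k)%:E)%E.
Proof.
have nn l : 0 <= 2 * (1 - cos (h * l)).
  by rewrite mulr_ge0// subr_ge0 cos_le1.
have mm n : measurable_fun setT (fun l => (2 * (1 - cos (h * l))) ^+ n).
  apply: measurable_funX; apply: measurable_funM => //.
  by apply: measurable_funB => //; exact: measurable_cosZ.
elim: k x => [|k IH] x.
  rewrite (eq_integral (cst 1%E)); last by move=> l _; rewrite expr0.
  by rewrite integral_cst// mul1e; exact: (esym (scalar_measureT E x)).
have [mD iD] := difference1_spectral h x.
rewrite /difference iterSr -/(difference E k h _) IH.
rewrite (integral_spectral_int mD iD)//.
- apply: eq_integral => l _; rewrite -EFinM [in RHS]exprSr; congr (EFin (_ * _)).
  rewrite sqr_rnormC /=.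
  transitivity ((cos (h * l) ^+ 2 + sin (h * l) ^+ 2) + 1 - 2 * cos (h * l)).
    by ring.
  by rewrite cos2Dsin2; ring.
- exact/measurable_EFinP.
Qed.

Lemma rnorm_difference_le k h x :
  rnorm (difference E k h x) ^+ 2 <= 4 ^+ k * rnorm x ^+ 2.
Proof.
rewrite -lee_fin sqr_rnorm_difference EFinM -(scalar_measureT E) -integral_cst//.
have nn l : 0 <= 2 * (1 - cos (h * l)).
  by rewrite mulr_ge0// subr_ge0 cos_le1.
apply: ge0_le_integral => //.
- apply/measurable_EFinP; apply: measurable_funX; apply: measurable_funM => //.
  by apply: measurable_funB => //; exact: measurable_cosZ.
- move=> l _; rewrite lee_fin /= lerXn2r ?nnegrE//.
  by have := cos_geN1 (h * l); lra.
Qed.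

(** The differences are bounded by [2 ^ k |x|], so the supremum is a genuine one. *)
Lemma le_modulus_of_continuity k t tau x : 0 < tau <= t ->
  rnorm (difference E k tau x) <= modulus_of_continuity E k t x.
Proof.
move=> tt; apply: ub_le_sup; last by exists tau.
exists (2 ^+ k * rnorm x) => _ [u _ <-].
rewrite -(@ler_pXn2r _ 2) ?nnegrE ?mulr_ge0 ?exprn_ge0 ?rnorm_ge0//.
rewrite exprMn -exprM mulnC exprM (_ : 2 ^+ 2 = 4); first exact: rnorm_difference_le.
by ring.
Qed.

End Differences.

(** * Sine-weighted moments of powers of 1 - cos *)

Section SineWeightedPowers.
Context (R : realType).
Implicit Types (s t : R) (k : nat).

Definition sine_moment k s : R :=
  \int[lebesgue_measure]_(t in `[0, pi]) (sin t * (1 - cos (s * t)) ^+ k).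

Lemma continuous_ver s : continuous (fun t => 1 - cos (s * t)).
Proof.
move=> t; apply: cvgB; first exact: cvg_cst.
apply: continuous_comp; last exact: continuous_cos.
by apply: cvgM; [exact: cvg_cst|exact: cvg_id].
Qed.

Lemma continuous_sine_ver k s :
  continuous (fun t => sin t * (1 - cos (s * t)) ^+ k).
Proof.
move=> t; apply: cvgM; first exact: continuous_sin.
apply: (@continuous_comp _ _ _ (fun t => 1 - cos (s * t)) (fun u => u ^+ k)).
  exact: continuous_ver.
exact: exprn_continuous.
Qed.

Lemma integrable_sine_ver k s : lebesgue_measure.-integrable `[0, pi]
  (EFin \o (fun t => sin t * (1 - cos (s * t)) ^+ k)).
Proof.
apply: continuous_compact_integrable; first exact: segment_compact.
by apply: continuous_subspaceT => t; exact: continuous_sine_ver.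
Qed.

Lemma Rintegral_FTC2 (f F : R -> R) (a b : R) : a < b -> continuous f ->
  (forall t, is_derive t 1 F (f t)) ->
  \int[lebesgue_measure]_(t in `[a, b]) f t = F b - F a.
Proof.
move=> ab cf dF.
have cF t : {for t, continuous F}.
  apply: differentiable_continuous; rewrite -derivable1_diffP.
  by apply: ex_derive.
rewrite /Rintegral (@continuous_FTC2 _ f F)//.
- by apply: continuous_subspaceT => t; exact: cf.
- split.
  + by move=> t _; apply: ex_derive.
  + exact/cvg_at_right_filter/cF.
  + exact/cvg_at_left_filter/cF.
- by move=> t _; rewrite derive1E derive_val.
Qed.

Lemma is_derive_mull s t : is_derive t 1 (fun t => s * t) s.
Proof. by apply: is_derive_eq; rewrite /GRing.scale /= mulr1. Qed.

Lemma is_derive_sinZ s t :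
  is_derive t 1 (fun t => sin (s * t)) (s * cos (s * t)).
Proof.
have h1 := is_derive_mull s t.
by apply: (is_derive_eq (is_derive1_comp (is_derive_sin (s * t)) h1)); rewrite mulrC.
Qed.

Lemma is_derive_ver s t :
  is_derive t 1 (fun t => 1 - cos (s * t)) (s * sin (s * t)).
Proof.
have h1 := is_derive_mull s t.
have h := is_deriveB (is_derive_cst (1 : R) t (1 : R))
  (is_derive1_comp (is_derive_cos (s * t)) h1).
by apply: (is_derive_eq h); rewrite sub0r mulNr opprK mulrC.
Qed.

Lemma is_derive_verX k s t :
  is_derive t 1 (fun t => (1 - cos (s * t)) ^+ k)
    (k%:R * (1 - cos (s * t)) ^+ k.-1 * (s * sin (s * t))).
Proof. by have := is_deriveX k (is_derive_ver s t); rewrite exprfctE. Qed.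

Lemma sine_moment0 s : sine_moment 0 s = 2.
Proof.
have d t : is_derive t 1 (- cos) (sin t * (1 - cos (s * t)) ^+ 0).
  by rewrite expr0 mulr1 -[sin t]opprK; exact: is_deriveN.
rewrite /sine_moment (Rintegral_FTC2 (pi_gt0 R) (@continuous_sine_ver 0 s) d).
by rewrite !fctE cospi cos0 opprK; ring.
Qed.


Let primitive k s t : R :=
  sin t * (k.+1%:R * (1 - cos (s * t)) ^+ k * (s * sin (s * t))) -
  cos t * (1 - cos (s * t)) ^+ k.+1.

(** With [g(t) = (1 - cos (s t))^(k+1)], [primitive] is [sin g' - cos g], whose
    derivative is [sin (g + g'')].  The identity
    [sin(s t)^2 = v (2 - v)], where [v = 1 - cos (s t)], expresses [g''] by the
    powers [v ^ k] and [v ^ (k+1)]. *)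
Lemma is_derive_primitive k s t : is_derive t 1 (primitive k s)
  (s ^+ 2 * k.+1%:R * (k.+1 + k)%:R * (sin t * (1 - cos (s * t)) ^+ k) -
   (s ^+ 2 * k.+1%:R ^+ 2 - 1) * (sin t * (1 - cos (s * t)) ^+ k.+1)).
Proof.
have d1 := is_deriveM (is_derive_cst (k.+1%:R : R) t (1 : R)) (is_derive_verX k s t).
have d2 := is_deriveM (is_derive_cst s t (1 : R)) (is_derive_sinZ s t).
have d3 := is_deriveM (is_derive_sin t) (is_deriveM d1 d2).
have d4 := is_deriveM (is_derive_cos t) (is_derive_verX k.+1 s t).
apply: (is_derive_eq (is_deriveB d3 d4)).
rewrite /GRing.scale /= !mulr0 !addr0.
set v : R := 1 - cos (s * t).
have sv : sin (s * t) ^+ 2 = v * (2 - v).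
  have := cos2Dsin2 (s * t) => c1.
  transitivity ((cos (s * t) ^+ 2 + sin (s * t) ^+ 2) - cos (s * t) ^+ 2).
    by ring.
  by rewrite c1 /v; ring.
have cv : cos (s * t) = 1 - v by rewrite /v; ring.
have kv : k%:R * v ^+ k.-1 * v = k%:R * v ^+ k.
  by case: (k) => [|j]; rewrite ?mul0r// -mulrA -exprSr.
rewrite !fctE -/v cv.
(* free variables detach the identity from the derivation rules, whose terms are
   built from the operations of [R] as a module over itself *)
have polyE (N n p q q' u S C a : R) :
    S * (N * q * (s * (s * (1 - u))) + s * a * (N * (n * p * (s * a)))) +
    N * q * (s * a) * C - (C * (N * q * (s * a)) + q' * - S) =
    s ^+ 2 * N * S * (q * (1 - u) + n * p * a ^+ 2) + q' * S by ring.
have polyE' (N n q u S : R) : N = n + 1 ->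
    s ^+ 2 * N * S * (q * (1 - u) + n * q * (2 - u)) + u * q * S =
    s ^+ 2 * N * (N + n) * (S * q) - (s ^+ 2 * N ^+ 2 - 1) * (S * (u * q)).
  by move=> ->; ring.
rewrite [LHS]polyE sv (mulrA _ v) kv [v ^+ k.+1]exprS natrD.
by rewrite [LHS]polyE' ?natr1.
Qed.

Lemma sine_moment_rec k s :
  (s ^+ 2 * k.+1%:R ^+ 2 - 1) * sine_moment k.+1 s =
  s ^+ 2 * k.+1%:R * (k.+1 + k)%:R * sine_moment k s - (1 - cos (s * pi)) ^+ k.+1.
Proof.
have cZ (c : R) n : continuous (fun t => c * (sin t * (1 - cos (s * t)) ^+ n)).
  by move=> t; apply: cvgM; [exact: cvg_cst|exact: continuous_sine_ver].
have iZ c n : lebesgue_measure.-integrable `[0, pi]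
    (EFin \o (fun t => c * (sin t * (1 - cos (s * t)) ^+ n))).
  apply: continuous_compact_integrable; first exact: segment_compact.
  by apply: continuous_subspaceT => t; exact: cZ.
have := Rintegral_FTC2 (pi_gt0 R) _ (is_derive_primitive k s).
rewrite RintegralB// !RintegralZl//; [|exact: integrable_sine_ver..].
rewrite /primitive sinpi sin0 cospi cos0 !mul0r mulr0 cos0 subrr expr0n /=.
rewrite mulr0 mulN1r opprK add0r !subr0 => <-; first by rewrite -/(sine_moment k s) subKr.
by move=> t; apply: cvgB; exact: cZ.
Qed.

(** Induction along [sine_moment_rec]: bounding [1 - cos (s pi)] by [2], the
    bound for [k] gives the bound for [k + 1] because [k (s^2 - 1) >= 0].  The
    bound is the value at [s = 1], where the substitution [u = 1 - cos t] makes
    the moment [\int_0^2 u^k du]. *)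
Lemma sine_moment_ge k s : 1 < s -> 2 ^+ k.+1 / k.+1%:R <= sine_moment k s.
Proof.
move=> s1; elim: k => [|k IH]; first by rewrite sine_moment0 expr1 divr1.
have rec := sine_moment_rec k s.
have w0 : 0 <= 1 - cos (s * pi) by rewrite subr_ge0 cos_le1.
have w2 : (1 - cos (s * pi)) ^+ k.+1 <= 2 ^+ k.+1.
  by rewrite lerXn2r ?nnegrE//; have := cos_geN1 (s * pi); lra.
have s2 : 1 < s ^+ 2 by rewrite exprn_egt1// ltW.
have k0 : 0 <= k%:R :> R by [].
have c0 : 0 < s ^+ 2 * k.+1%:R ^+ 2 - 1 by rewrite -natr1; nra.
have p2 : 0 < 2 ^+ k.+1 :> R by rewrite exprn_gt0.
have IH' : s ^+ 2 * (k.+1 + k)%:R * 2 ^+ k.+1 <=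
    s ^+ 2 * k.+1%:R * (k.+1 + k)%:R * sine_moment k s.
  have -> : s ^+ 2 * (k.+1 + k)%:R * 2 ^+ k.+1 =
      s ^+ 2 * k.+1%:R * (k.+1 + k)%:R * (2 ^+ k.+1 / k.+1%:R).
    by field; rewrite nat1r pnatr_eq0.
  by apply: ler_wpM2l IH; rewrite !mulr_ge0 // (le_trans ler01) // ltW.
rewrite -(ler_pM2l c0) rec mulrA ler_pdivrMr//.
apply: le_trans (_ : (s ^+ 2 * (k.+1 + k)%:R * 2 ^+ k.+1 - 2 ^+ k.+1) * k.+2%:R <= _).
  rewrite [2 ^+ k.+2]exprS -[k.+2%:R]natr1 natrD -[k.+1%:R]natr1.
  rewrite -subr_ge0.
  set P := 2 ^+ k.+1; set n := k%:R.
  rewrite (_ : _ - _ = P * (n * (s ^+ 2 - 1))); last by ring.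
  apply: mulr_ge0; first exact: ltW.
  by apply: mulr_ge0 => //; rewrite subr_ge0 ltW.
by rewrite ler_wpM2r// lerB.
Qed.

End SineWeightedPowers.

(** * The tail of a scalar measure *)

Section TailBound.
Context (R : realType) (H : hilbertType R) (E : projection_measure H).
Implicit Types (x y : H) (r : R) (k : nat).

Lemma integral_sine_moment k (s c : R) :
  (\int[lebesgue_measure]_(t in `[0%R, pi])
    (c * (sin t * (1 - cos (s * t)) ^+ k))%:E)%E = (c * sine_moment k s)%:E.
Proof.
have i := integrable_sine_ver k s.
under eq_integral do rewrite EFinM.
rewrite integralZl//= EFinM /sine_moment /Rintegral fineK//.
exact: integrable_fin_num.
Qed.

(** The moment depends on [s] through the even function [cos]. *)
Lemma sine_moment_norm k (s : R) : sine_moment k `|s| = sine_moment k s.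
Proof.
rewrite /sine_moment; apply: eq_Rintegral => t _.
by case: (ger0P s) => // _; rewrite mulNr cosN.
Qed.

(** Average [|Delta_(t/r)^k y|^2] over [0 <= t <= pi] against [sin t]. *)
Lemma scalar_measure_tail_le k r y : 0 < r ->
  (scalar_measure E y (~` `[(- r)%R, r]) <=
   (k.+1%:R / 4 ^+ k * modulus_of_continuity E k (pi / r) y ^+ 2)%:E)%E.
Proof.
move=> r0; set om := modulus_of_continuity _ _ _ _; set K := ~` _.
have mK : measurable K by apply: measurableC.
pose w t : R := sin t * \1_(`[0, pi]%classic) t.
have w0 t : 0 <= w t.
  rewrite /w indicE; case: (boolP (t \in _)) => [/set_mem/=|_]; rewrite ?mulr0 ?mulr1//.
  exact: sin_ge0_pi.
have mw : measurable_fun setT w.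
  apply: measurable_funM; last exact: measurable_indic.
  exact: (continuous_measurable_fun (@continuous_sin R)).
pose g (t l : R) : R := (2 * (1 - cos (t / r * l))) ^+ k.
have g0 t l : 0 <= g t l.
  by rewrite exprn_ge0// mulr_ge0// subr_ge0 cos_le1.
pose f (z : R * R) : \bar R := (w z.1 * g z.1 z.2)%:E.
have f0 z : (0 <= f z)%E by rewrite lee_fin mulr_ge0.
have mf : measurable_fun setT f.
  apply/measurable_EFinP; apply: measurable_funM.
    exact: (measurableT_comp mw measurable_fst).
  apply: measurable_funX; apply: measurable_funM => //; apply: measurable_funB => //.
  apply: (measurableT_comp (continuous_measurable_fun (@continuous_cos R))).
  by apply: measurable_funM => //; apply: measurable_funM.
have restr (h : R -> R) : (\int[lebesgue_measure]_t (w t * h t)%:E =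
    \int[lebesgue_measure]_(t in `[0%R, pi]) (sin t * h t)%:E)%E.
  rewrite [RHS]integral_mkcond; apply: eq_integral => t _.
  by rewrite /patch /w indicE; case: ifP => _; rewrite ?mulr1 ?mulr0 ?mul0r.
have fub := fubini_tonelli (m1 := lebesgue_measure) (m2 := scalar_measure E y) f mf f0.
have upper : (\int[lebesgue_measure]_t \int[scalar_measure E y]_l f (t, l) <=
    (2 * om ^+ 2)%:E)%E.
  have -> : (2 * om ^+ 2)%:E = (\int[lebesgue_measure]_t (w t * om ^+ 2)%:E)%E.
    rewrite restr mulrC -(sine_moment0 0) -integral_sine_moment.
    by apply: eq_integral => t _; rewrite expr0 mulr1 mulrC.
  apply: ge0_le_integral => //.
  - by move=> t _; apply: integral_ge0 => l _; exact: f0.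
  - exact: measurable_fun_fubini_tonelli_F.
  - by apply/measurable_EFinP; apply: measurable_funM.
  - move=> t _; rewrite /f /=.
    under eq_integral do rewrite EFinM.
    rewrite ge0_integralZl_EFin//; last 2 first.
    + by move=> l _; rewrite lee_fin.
    + apply/measurable_EFinP; apply: measurable_funX; apply: measurable_funM => //.
      by apply: measurable_funB => //; exact: measurable_cosZ.
    have -> : (\int[scalar_measure E y]_l (g t l)%:E)%E =
        (rnorm (difference E k (t / r) y) ^+ 2)%:E.
      by rewrite sqr_rnorm_difference.
    rewrite -EFinM lee_fin; have [/andP[t0 tpi]|nt] := boolP (0 < t <= pi).
      rewrite ler_wpM2l//.
      have td : rnorm (difference E k (t / r) y) <= om.
        by apply: le_modulus_of_continuity; rewrite divr_gt0//= ler_pM2r ?invr_gt0.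
      by rewrite ler_pXn2r ?nnegrE ?rnorm_ge0// (le_trans _ td) ?rnorm_ge0.
    have -> : w t = 0; last by rewrite !mul0r.
    rewrite /w indicE; case: (boolP (t \in _)) => [/set_mem/=|_]; rewrite ?mulr0//.
    rewrite in_itv/= => /andP[t0 tpi]; move: nt; rewrite tpi andbT -leNgt => t0'.
    by rewrite (@le_anti _ _ t 0) ?t0 ?t0'// sin0 mul0r.
have lower : ((2 ^+ k * (2 ^+ k.+1 / k.+1%:R))%:E * scalar_measure E y K <=
    \int[scalar_measure E y]_l \int[lebesgue_measure]_t f (t, l))%E.
  have c0 : 0 <= 2 ^+ k * (2 ^+ k.+1 / k.+1%:R) :> R by [].
  rewrite -integral_cst// integral_mkcond.
  apply: ge0_le_integral => //.
  - move=> l _; rewrite /patch; case: ifP => //; rewrite lee_fin.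
  - apply/(measurable_restrictT _ _).1 => //; exact: measurable_cst.
  - exact: measurable_fun_fubini_tonelli_G.
  - move=> l _; rewrite /patch; case: ifPn => [/set_mem Kl|_]; last first.
      by apply: integral_ge0 => t _; exact: f0.
    (* off [K] the frequency ratio exceeds 1, as the moment bound requires *)
    have sl : 1 < `|l / r|.
      rewrite normrM [`|r^-1|]gtr0_norm ?invr_gt0// ltr_pdivlMr// mul1r.
      rewrite ltNge; apply/negP => lr; apply: Kl => /=.
      by rewrite in_itv/= -ler_norml.
    rewrite /f /= restr.
    have -> : (\int[lebesgue_measure]_(t in `[0%R, pi]) (sin t * g t l)%:E =
        (2 ^+ k * sine_moment k (l / r))%:E)%E.
      rewrite -integral_sine_moment; apply: eq_integral => t _.
      by rewrite /g (_ : t / r * l = l / r * t) ?exprMn 1?mulrCA//; ring.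
    rewrite lee_fin ler_wpM2l// -sine_moment_norm; exact: sine_moment_ge.
rewrite fub in upper; have := le_trans lower upper.
have [m mE] : exists m, scalar_measure E y K = m%:E by eexists.
rewrite mE -EFinM !lee_fin => h.
have E4 : 4 ^+ k = 2 ^+ k * 2 ^+ k :> R by rewrite -exprMn; congr (_ ^+ _); ring.
have -> : k.+1%:R / 4 ^+ k * om ^+ 2 =
    (2 ^+ k * (2 ^+ k.+1 / k.+1%:R))^-1 * (2 * om ^+ 2).
  by rewrite E4 [2 ^+ k.+1]exprS; field; rewrite nat1r pnatr_eq0 /= expf_neq0.
by rewrite ler_pdivlMl// !mulr_gt0 ?invr_gt0// exprn_gt0.
Qed.

End TailBound.

(** * Band-limited vectors and the direct estimate *)

Section BandLimited.
Context (R : realType) (H : hilbertType R) (E : projection_measure H).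
Context (B : operator H) (hE : spectral_measure_of E B) (r : R) (r0 : 0 < r).
Implicit Types (x z : H).

Let K : set R := `[- r, r]%classic.
Let mK : measurable K. Proof. exact: measurable_itv. Qed.

Let mid : complex_measurable (fun l : R => l%:C).
Proof. by apply: complex_measurable_real; exact: measurable_id. Qed.

Lemma sqint_id_band z : E K z = z ->
  (sqint E z (fun l => l%:C) <= (r ^+ 2 * rnorm z ^+ 2)%:E)%E.
Proof.
move=> Kz; have m2 := measurable_sqr_rnorm mid.
rewrite /sqint -{1}Kz integral_scalar_measure_pm//; last 2 first.
- by move=> l; rewrite lee_fin sqr_ge0.
- exact/measurable_EFinP.
rewrite EFinM -{2}Kz -/(scalar_measure E z K) -integral_cst//.
apply: ge0_le_integral => //.
- by move=> l _; rewrite lee_fin sqr_ge0.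
- by apply/measurable_EFinP; exact: measurable_funTS.
- move=> l; rewrite /K /= in_itv/= -ler_norml => lr.
  by rewrite lee_fin rnorm_real ler_pXn2r ?nnegrE// ltW.
Qed.

(** If [z] lies in the range of [E K], its spectral measure lives on [[-r, r]],
    where the symbol of [B] is at most [r] in modulus. *)
Lemma band_step z : E K z = z ->
  [/\ opdom B z, E K (B z) = B z & rnorm (B z) <= r * rnorm z].
Proof.
move=> Kz; have [domB BE] := hE.
have fin : (sqint E z (fun l => l%:C) < +oo)%E.
  by apply: le_lt_trans (sqint_id_band Kz) _; rewrite ltry.
have dz : opdom B z by rewrite domB.
have iz : is_spectral_int E (fun l => l%:C) z (B z).
  by rewrite BE//; exact: spectral_opP.
split => //.
(* [B z] and [E K (B z)] are both integrals of the identity at [z], so they agree *)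
- have iK := is_spectral_int_pm mK mid iz; rewrite Kz in iK.
  have i0 := is_spectral_int_lin (-1) mid mid iz iK.
  have m0 := complex_measurable_lin (-1) mid mid.
  have := sqint_spectral_int m0 i0.
  rewrite /sqint integral0_eq; last first.
    by move=> l _; rewrite mulN1r addNr rnorm0 expr0n.
  move=> -[] /esym/eqP; rewrite sqrf_eq0 => /eqP n0.
  have : `|-1 *: B z + E K (B z)| = 0 by rewrite -rnormE n0.
  by move/normr0_eq0; rewrite scaleN1r addrC => /subr0_eq.
- have rz : 0 <= r * rnorm z by rewrite mulr_ge0 ?rnorm_ge0// ltW.
  rewrite -(@ler_pXn2r _ 2) ?nnegrE ?rnorm_ge0//.
  by rewrite exprMn -lee_fin -(sqint_spectral_int mid iz) sqint_id_band.
Qed.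

Lemma band_iter z n : E K z = z ->
  [/\ pow_dom B n z, E K (iter n B z) = iter n B z &
      rnorm (iter n B z) <= r ^+ n * rnorm z].
Proof.
move=> Kz; elim: n => [|n [dn Kn nn]]; first by split; rewrite //= expr0 mul1r.
have [d Kn1 nn1] := band_step Kn; split => //=.
by apply: (le_trans nn1); rewrite exprS -mulrA ler_wpM2l// ltW.
Qed.

(** Every power of [B] multiplies the norm of [E K x] by at most [r], so this
    vector competes in the infimum, and its distance to [x] is the norm of the
    complementary projection. *)
Lemma best_approx_le x : best_approx r x B <= rnorm (E (~` K) x).
Proof.
set p := E K x; have Kp : E K p = p by exact: pm_idem.
have pe : exp_type_le r B p.
  split; first by move=> n _; have [] := band_iter n Kp.
  (* the constant must be positive, also when [p = 0] *)
  exists (rnorm p + 1); first by rewrite ltr_wpDl ?rnorm_ge0.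
  move=> n; have [_ _ /le_trans] := band_iter n Kp; apply.
  by rewrite mulrC ler_wpM2r ?exprn_ge0 ?ltW// ltrDl.
rewrite -pm_subr_setC//; apply: ge_inf.
  by exists 0 => _ [y _ <-]; exact: rnorm_ge0.
exists p => //; split; first by exists r.
apply: ge_inf => //.
by exists 0 => a [a0 _]; exact: ltW.
Qed.
End BandLimited.

Theorem theorem1p1 (R : realType) (H : hilbertType R) (hH : separable H)
    (B : operator H) (hB : self_adjoint B)
    (E : projection_measure H) (hE : spectral_measure_of E B)
    (G : R -> R) (G_ge0 : forall l : R, 0 <= G l)
    (G_even : forall l : R, G (- l) = G l)
    (G_ndecr : forall l m : R, 0 <= l -> l <= m -> G l <= G m)
    (x : H) (hx : opdom (real_spectral_op E G) x)
    (k : nat) (hk : (1 <= k)%N) (r : R) (hr : 0 < r) (hGr : 0 < G r) :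
  best_approx r x B <=
    Num.sqrt (k.+1%:R) / (2 ^+ k * G r) *
      modulus_of_continuity E k (pi / r) (real_spectral_op E G x).
Proof.
set y := real_spectral_op E G x; set om := modulus_of_continuity _ _ _ _.
set K := `[- r, r]%classic.
have mK : measurable (~` K) by apply: measurableC; exact: measurable_itv.
(* [G] is a nondecreasing function composed with the absolute value, hence Borel;
   the maximum extends the nondecreasing function by a constant to the negative axis *)
have GE l : G l = G (Num.max 0 `|l|).
  by rewrite max_r//; case: (ger0P l) => // _; rewrite G_even.
have mG : measurable_fun setT G.
  rewrite (_ : G = (fun l => G (Num.max 0 l)) \o Num.norm); last exact/funext.
  apply: measurableT_comp; last exact: normr_measurable.
  apply: nondecreasing_measurable => // a b ab.
  apply: G_ndecr; first by rewrite le_max lexx.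
  by rewrite ge_max !le_max lexx ab orbT.
have mGC := complex_measurable_real mG.
have iy : is_spectral_int E (fun l => (G l)%:C) x y by exact: spectral_opP.
have mG2 := measurable_sqr_rnorm mGC.
have tail : ((G r ^+ 2)%:E * scalar_measure E x (~` K) <= scalar_measure E y (~` K))%E.
  rewrite (scalar_measure_spectral_int mK mGC iy) -integral_cst//.
  apply: ge0_le_integral => //.
  - by move=> l _; rewrite lee_fin sqr_ge0.
  - by apply/measurable_EFinP; exact: measurable_funTS.
  - move=> l Kl; rewrite lee_fin rnorm_real ger0_norm// ler_pXn2r ?nnegrE//.
    rewrite [leRHS]GE; apply: G_ndecr; first exact: ltW.
    rewrite max_r// leNgt; apply/negP => lr; apply: Kl.
    by rewrite /K /= in_itv/= -ler_norml ltW.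
have om0 : 0 <= om.
  apply: le_trans (rnorm_ge0 _) (@le_modulus_of_continuity _ _ _ _ _ (pi / r) _ _).
  by rewrite lexx divr_gt0 ?pi_gt0.
have := le_trans tail (scalar_measure_tail_le E k y hr).
rewrite /scalar_measure -EFinM lee_fin -/om => key.
apply: le_trans (best_approx_le hE hr x) _; rewrite -/K.
have P0 : 0 < 2 ^+ k * G r by rewrite mulr_gt0 ?exprn_gt0.
have rhs0 : 0 <= Num.sqrt (k.+1%:R) / (2 ^+ k * G r) * om.
  by rewrite mulr_ge0// divr_ge0 ?sqrtr_ge0// ltW.
rewrite -(@ler_pXn2r _ 2) ?nnegrE ?rnorm_ge0//.
rewrite exprMn expr_div_n sqr_sqrtr// exprMn -exprM mulnC exprM.
have -> : (2 : R) ^+ 2 = 4 by ring.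
rewrite -(ler_pM2l (_ : 0 < G r ^+ 2)) ?exprn_gt0//.
apply: le_trans key _; rewrite le_eqVlt; apply/orP; left; apply/eqP.
by field; rewrite gt_eqF// expf_neq0// pnatr_eq0.
Qed.
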